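(* Let $N,M\ge 1$ be integers and let $S$ be a 2-string with $|S|=2N$. Then the rational function $F_S(x_1,\dots,x_N;\bm{z})$ is symmetric in $(x_1,\dots,x_N)$, and the rational function $G_S(y_1,\dots,y_M;\bm{z})$ is symmetric in $(y_1,\dots,y_M)$.
   Context: **Weights.** All parameters ($q$ and the spectral parameters) are generic/indeterminates; all identities are between rational functions. For $i,j,k,\ell\in\{0,1,2\}$ the Izergin--Korepin vertex weight $W_{y/x}(i,j;k,\ell)$ ($i$ = bottom incoming state, $j$ = left incoming state, $k$ = top outgoing state, $\ell$ = right outgoing state; $x$ = parameter of the horizontal line, $y$ = parameter of the vertical line) depends on $x,y$ only through $y/x$, and, with $D=(x-q^2y)(x-q^3y)$, is given by $W(0,0;0,0)=W(2,2;2,2)=1$; $W(1,0;1,0)=W(2,1;2,1)=\frac{q^2(x-y)}{x-q^2y}$; $W(1,0;0,1)=W(2,1;1,2)=\frac{(1-q^2)x}{x-q^2y}$; $W(0,1;1,0)=W(1,2;2,1)=\frac{(1-q^2)y}{x-q^2y}$; $W(0,1;0,1)=W(1,2;1,2)=\frac{x-y}{x-q^2y}$; $W(2,0;2,0)=\frac{q^4(x-y)(x-qy)}{D}$; $W(2,0;1,1)=-\frac{q(1-q)^2(1+q)x(x-y)}{D}$; $W(2,0;0,2)=\frac{(1-q^2)x(x+qx-qy-q^3y)}{D}$; $W(1,1;2,0)=-\frac{q^4(1+q)(x-y)y}{D}$; $W(1,1;1,1)=\frac{-qx^2+(1+q)(1-q^2+q^4)xy-q^4y^2}{D}$; $W(1,1;0,2)=\frac{(1+q)x(x-y)}{D}$;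 $W(0,2;2,0)=\frac{(1-q^2)(x+q^2x-q^2y-q^3y)y}{D}$; $W(0,2;1,1)=\frac{q(1-q)^2(1+q)(x-y)y}{D}$; $W(0,2;0,2)=\frac{(x-y)(x-qy)}{D}$; and $W=0$ in all other cases. **2-strings.** A 2-string is an infinite vector $S=(S_1,S_2,\dots)$ with $S_i\in\{0,1,2\}$ and only finitely many nonzero entries; $|S|=\sum_i S_i$. Trailing zeros may be dropped. $\bm{z}=(z_1,z_2,\dots)$ is an infinite alphabet. **$F_S$.** Let $|S|=2N$ and choose $L$ with $S_c=0$ for $c>L$. Then $$F_S(x_1,\dots,x_N;\bm{z})=\sum\prod_{r=1}^{N}\prod_{c=1}^{L}W_{z_c/x_r}(v_{r-1,c},h_{r,c-1};v_{r,c},h_{r,c}),$$ summed over all $h_{r,c}\in\{0,1,2\}$ ($1\le r\le N$, $0\le c\le L$) and $v_{r,c}\in\{0,1,2\}$ ($0\le r\le N$, $1\le c\le L$) with $h_{r,0}=2$, $h_{r,L}=0$, $v_{0,c}=0$, $v_{N,c}=S_c$. (Independent of the choice of $L$.) **$G_S$.** Let $|S|=2N$ and choose $L\ge N$ with $S_c=0$ for $c>L$. Then $$G_S(y_1,\dots,y_M;\bm{z})=\sum\prod_{r=1}^{M}\prod_{c=1}^{L}W_{z_c/y_r}(v_{r-1,c},h_{r,c-1};v_{r,c},h_{r,c}),$$ summed over all $h_{r,c},v_{r,c}\in\{0,1,2\}$ with $h_{r,0}=h_{r,L}=0$, $v_{0,c}=2$ for $c\le N$, $v_{0,c}=0$ for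 $c>N$, and $v_{M,c}=S_c$. (Independent of $L$.) *)

(* Defs.v *)
From HB Require Import structures.
From mathcomp Require Import all_boot all_order all_fingroup all_algebra.
From mathcomp Require Import finmap mpoly.

Set Implicit Arguments.
Unset Strict Implicit.
Unset Printing Implicit Defensive.

Import GRing.Theory.
Local Open Scope ring_scope.

(** Izergin-Korepin vertex weight W_{y/x}(i, j; k, l), with i = bottom,
    j = left (incoming), k = top, l = right (outgoing); x is the parameter of
    the horizontal line and y that of the vertical line. *)
Definition ik_weight (E : fieldType) (q x y : E) (i j k l : 'I_3) : E :=
  let d := x - q ^+ 2 * y in
  let D := (x - q ^+ 2 * y) * (x - q ^+ 3 * y) in
  match nat_of_ord i, nat_of_ord j, nat_of_ord k, nat_of_ord l with
  | 0%N, 0%N, 0%N, 0%N | 2%N, 2%N, 2%N, 2%N => 1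
  | 1%N, 0%N, 1%N, 0%N | 2%N, 1%N, 2%N, 1%N => q ^+ 2 * (x - y) / d
  | 1%N, 0%N, 0%N, 1%N | 2%N, 1%N, 1%N, 2%N => (1 - q ^+ 2) * x / d
  | 0%N, 1%N, 1%N, 0%N | 1%N, 2%N, 2%N, 1%N => (1 - q ^+ 2) * y / d
  | 0%N, 1%N, 0%N, 1%N | 1%N, 2%N, 1%N, 2%N => (x - y) / d
  | 2%N, 0%N, 2%N, 0%N => q ^+ 4 * (x - y) * (x - q * y) / D
  | 2%N, 0%N, 1%N, 1%N =>
      - (q * (1 - q) ^+ 2 * (1 + q) * x * (x - y)) / D
  | 2%N, 0%N, 0%N, 2%N =>
      (1 - q ^+ 2) * x * (x + q * x - q * y - q ^+ 3 * y) / D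
  | 1%N, 1%N, 2%N, 0%N => - (q ^+ 4 * (1 + q) * (x - y) * y) / D
  | 1%N, 1%N, 1%N, 1%N =>
      (- (q * x ^+ 2) + (1 + q) * (1 - q ^+ 2 + q ^+ 4) * x * y
       - q ^+ 4 * y ^+ 2) / D
  | 1%N, 1%N, 0%N, 2%N => (1 + q) * x * (x - y) / D
  | 0%N, 2%N, 2%N, 0%N =>
      (1 - q ^+ 2) * (x + q ^+ 2 * x - q ^+ 2 * y - q ^+ 3 * y) * y / D
  | 0%N, 2%N, 1%N, 1%N => q * (1 - q) ^+ 2 * (1 + q) * (x - y) * y / D
  | 0%N, 2%N, 0%N, 2%N => (x - y) * (x - q * y) / D
  | _, _, _, _ => 0
  end.

Definition st0 : 'I_3 := @Ordinal 3 0 isT.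
Definition st2 : 'I_3 := @Ordinal 3 2 isT.

(** Partition function of an R x L lattice.  Rows are numbered from the bottom
    and columns from the left, both from 0.  [h (r, c)] is the state of the
    horizontal edge of row r to the left of column c (to the right of column
    c - 1), and [v (r, c)] that of the vertical edge of column c below row r
    (above row r - 1).  The left, right, bottom and top boundary states are
    [hl], [hr], [vb] and [vt]. *)
Definition lattice_sum (E : fieldType) (q : E) (R L : nat)
    (x : 'I_R -> E) (z : 'I_L -> E)
    (hl hr : 'I_3) (vb vt : 'I_L -> 'I_3) : E :=
  \sum_(h : {ffun 'I_R * 'I_L.+1 -> 'I_3} |
          [forall r, (h (r, ord0) == hl) && (h (r, ord_max) == hr)])
  \sum_(v : {ffun 'I_R.+1 * 'I_L -> 'I_3} |
          [forall c, (v (ord0, c) == vb c) && (v (ord_max, c) == vt c)])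
  \prod_(r < R) \prod_(c < L)
     ik_weight q (x r) (z c)
       (v (widen_ord (leqnSn R) r, c)) (h (r, widen_ord (leqnSn L) c))
       (v (lift ord0 r, c)) (h (r, lift ord0 c)).

(** A 2-string; the entry S_{c+1} is [S c]. *)
Notation two_string := {fsfun nat -> 'I_3 with st0}.

Definition string_size (S : two_string) : nat :=
  (\sum_(c <- finsupp S) S c)%N.

Definition string_length_le (S : two_string) (L : nat) : Prop :=
  forall c : nat, (L <= c)%N -> S c = st0.

(** The field K(q, x_1, ..., x_R, z_1, ..., z_L), with variable 0 being q,
    followed by the x's and then the z's.  For any L beyond the last nonzero
    entry of a 2-string, only z_1, ..., z_L of the infinite alphabet occur. *)
Notation ratfun K R L := {fraction {mpoly K[1 + R + L]}}.

Definition qidx (R L : nat) : 'I_(1 + R + L) := lshift L (lshift R ord0).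
Definition xidx (R L : nat) (r : 'I_R) : 'I_(1 + R + L) :=
  lshift L (rshift 1 r).
Definition zidx (R L : nat) (c : 'I_L) : 'I_(1 + R + L) := rshift (1 + R) c.

Definition ratvar (K : fieldType) (R L : nat) (i : 'I_(1 + R + L)) :
  ratfun K R L := FracField.tofrac 'X_i.

Definition F_fun (K : fieldType) (N L : nat) (S : two_string) : ratfun K N L :=
  lattice_sum (ratvar K (qidx N L))
    (fun r => ratvar K (xidx L r)) (fun c => ratvar K (zidx N c))
    st2 st0 (fun=> st0) (fun c => S c).

(** The rows carry the M parameters y; N is half the size of S. *)
Definition G_fun (K : fieldType) (N M L : nat) (S : two_string) :
    ratfun K M L :=
  lattice_sum (ratvar K (qidx M L))
    (fun r => ratvar K (xidx L r)) (fun c => ratvar K (zidx M c))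
    st0 st0 (fun c => if (c < N)%N then st2 else st0) (fun c => S c).

(** Permutation of the variables of a rational function: the field
    automorphism extending [msym s].  The definition uses a chosen
    representative; [ratsym_frac] shows that this choice is immaterial. *)
Definition ratsym (K : fieldType) (n : nat) (s : 'S_n)
    (f : {fraction {mpoly K[n]}}) : {fraction {mpoly K[n]}} :=
  FracField.tofrac (msym s \n_(generic_quotient.repr f)) /
  FracField.tofrac (msym s \d_(generic_quotient.repr f)).

Lemma ratsym_frac (K : fieldType) (n : nat) (s : 'S_n) (a b : {mpoly K[n]}) :
  b != 0 ->
  ratsym s (FracField.tofrac a / FracField.tofrac b) =
  FracField.tofrac (msym s a) / FracField.tofrac (msym s b).
Proof.
move=> b_neq0; set f := _ / _; rewrite /ratsym.
have repK (g : {fraction {mpoly K[n]}}) :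
    g = FracField.tofrac \n_(generic_quotient.repr g) /
        FracField.tofrac \d_(generic_quotient.repr g).
  set r := generic_quotient.repr g.
  have d_neq0 := denom_ratioP r.
  apply: (canRL (mulfK _)); first by rewrite tofrac_eq0.
  rewrite -[g in LHS]generic_quotient.reprK -/r.
  unlock FracField.tofrac; rewrite -[LHS]FracField.pi_mul.
  apply/eqP; rewrite FracField.equivf_def /FracField.mulf.
  by rewrite !numden_Ratio ?mulf_neq0 ?oner_eq0 // !mulr1 mulrC.
set r := generic_quotient.repr f.
have d_neq0 : \d_r != 0 := denom_ratioP r.
have msym_neq0 (p : {mpoly K[n]}) : p != 0 -> msym s p != 0.
  by apply: contraNneq => p0; apply/eqP/(inj_msym s); rewrite p0 msym0.
have : f = FracField.tofrac \n_r / FracField.tofrac \d_r := repK f.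
move/eqP; rewrite /f eqr_div ?tofrac_eq0 // -!tofracM tofrac_eq => /eqP e.
apply/eqP; rewrite eqr_div ?tofrac_eq0 ?msym_neq0 // -!tofracM tofrac_eq.
by rewrite -!msymM e.
Qed.

(** Symmetry in the variables x_1, ..., x_R, the others being fixed. *)
Definition symmetric_in_x (K : fieldType) (R L : nat) (f : ratfun K R L) :
    Prop :=
  forall s : 'S_(1 + R + L),
    perm_on [set xidx L r | r : 'I_R] s -> ratsym s f = f.

(* Main.v *)
Require Import Defs.
From HB Require Import structures.
From mathcomp Require Import all_boot all_order all_fingroup all_algebra.
From mathcomp Require Import finmap mpoly.
From mathcomp Require Import ring zify.

Set Implicit Arguments.
Unset Strict Implicit.
Unset Printing Implicit Defensive.

Import GRing.Theory.
Local Open Scope ring_scope.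

(** Both functions are partition functions of a lattice whose rows carry the
    parameters x_r, so they are matrix entries of a product of one-row
    transfer operators, one for each x_r ([lattice_sum_rows]). It suffices that
    two such operators commute ([row_weight_comm]).

    This follows from the Yang-Baxter equation ([yang_baxter]). Let two
    adjacent rows of parameters a and b be given. Insert at their left end a
    crossing of the two horizontal lines, that is a vertex of weight W_(b/a).
    For F both lines enter in state 2, for G both enter in state 0; in either
    case the crossing has only one nonzero weight, equal to 1, and changes
    nothing. The Yang-Baxter equation moves the crossing through the columns
    one at a time ([kprod_intertwine]), exchanging a and b in each column it
    passes. At the right end both lines are in state 0, and the crossing is
    again trivial and can be removed.

    The Yang-Baxter equation is a finite set of identities between rational
    functions of q, a, b and z. All weights of a vertex have the common
    denominator (x - q^2 y) (x - q^3 y), so after multiplication by the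
    denominators they become identities between polynomials with integer
    coefficients, which hold in every commutative ring
    ([ik_num_yang_baxter]); particle conservation leaves 141 of them.

    Finally, permuting the variables x_r is an automorphism of the field of
    rational functions, so it sends the lattice sum to the lattice sum with
    permuted row parameters ([lattice_sum_rmorph]). The denominators do not
    vanish, since the parameters are independent variables
    ([ratvar_regular]). *)

(** * Products of kernels and sums over paths *)

(** A kernel on a finite set [T] is a matrix with rows and columns indexed by
    [T], written as a function; [kcomp] is the matrix product, and [kprod] the
    product of a list of kernels, the identity for the empty list. *)
Definition kcomp (E : comPzRingType) (T : finType) (A B : T -> T -> E) :
  T -> T -> E := fun a b => \sum_t A a t * B t b.

Definition kprod (E : comPzRingType) (T : finType) (Ks : seq (T -> T -> E)) :
  T -> T -> E := foldr (@kcomp E T) (fun a b => (a == b)%:R) Ks.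

(** The tensor product of two kernels. *)
Definition ktens (E : comPzRingType) (T U : finType)
    (A : T -> T -> E) (B : U -> U -> E) : T * U -> T * U -> E :=
  fun p p' => A p.1 p'.1 * B p.2 p'.2.

Section Kernels.

Variable E : comPzRingType.

Lemma kcompA (T : finType) (A B C : T -> T -> E) :
  kcomp A (kcomp B C) =2 kcomp (kcomp A B) C.
Proof.
move=> a b; rewrite /kcomp.
under eq_bigr do rewrite big_distrr /=.
rewrite exchange_big /=; apply: eq_bigr => t _; rewrite big_distrl /=.
by apply: eq_bigr => u _; rewrite mulrA.
Qed.

Lemma eq_kcomp (T : finType) (A A' B B' : T -> T -> E) :
  A =2 A' -> B =2 B' -> kcomp A B =2 kcomp A' B'.
Proof. by move=> eA eB a b; apply: eq_bigr => t _; rewrite eA eB. Qed.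

Lemma kcomp1k (T : finType) (A : T -> T -> E) :
  kcomp (fun a b => (a == b)%:R) A =2 A.
Proof.
move=> a b; rewrite /kcomp (bigD1 a) //= eqxx mul1r big1 ?addr0 // => t.
by rewrite eq_sym => /negPf->; rewrite mul0r.
Qed.

Lemma kcompk1 (T : finType) (A : T -> T -> E) :
  kcomp A (fun a b => (a == b)%:R) =2 A.
Proof.
move=> a b; rewrite /kcomp (bigD1 b) //= eqxx mulr1 big1 ?addr0 // => t.
by move=> /negPf->; rewrite mulr0.
Qed.

(** Pairwise commuting kernels can be multiplied in any order. *)
Lemma kprod_perm (I : eqType) (T : finType) (K : I -> T -> T -> E)
    (s t : seq I) :
  (forall i j, kcomp (K i) (K j) =2 kcomp (K j) (K i)) -> perm_eq s t ->
  kprod [seq K i | i <- s] =2 kprod [seq K i | i <- t].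
Proof.
move=> KC.
(* A factor can be moved in front of those that precede it. *)
have front i t1 t2 : kprod [seq K j | j <- i :: (t1 ++ t2)] =2
    kprod [seq K j | j <- t1 ++ i :: t2].
  elim: t1 => [|j t1 IHt] //= a b.
  rewrite -(eq_kcomp (fun _ _ => erefl) IHt) /= !kcompA.
  exact: (eq_kcomp (KC i j)).
elim: s t => [|i s IHs] t; first by move/perm_size/esym/size0nil->.
move=> st; have it : i \in t by rewrite -(perm_mem st) mem_head.
case/splitPr: it st => t1 t2; rewrite perm_sym (perm_catCA t1 [:: i]) perm_cons.
rewrite perm_sym => st.
move=> a b; rewrite -front /=; exact: (eq_kcomp _ (IHs _ st)).
Qed.

(** If [R] intertwines the kernels [A i] and [B i] one by one, it intertwines
    their products: the crossing [R] moves through the factors. *)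
Lemma kprod_intertwine (I : Type) (T : finType) (R : T -> T -> E)
    (A B : I -> T -> T -> E) (s : seq I) :
  (forall i, kcomp R (A i) =2 kcomp (B i) R) ->
  kcomp R (kprod [seq A i | i <- s]) =2 kcomp (kprod [seq B i | i <- s]) R.
Proof.
move=> RAB; elim: s => [|i s IHs] a b /=; first by rewrite kcompk1 kcomp1k.
rewrite kcompA (eq_kcomp (RAB i) (fun _ _ => erefl)) -!kcompA.
exact: (eq_kcomp (fun _ _ => erefl) IHs).
Qed.

(** Two parallel paths are one path of pairs of states. *)
Lemma kprod_tens (I : Type) (T U : finType) (A : I -> T -> T -> E)
    (B : I -> U -> U -> E) (s : seq I) p p' :
  kprod [seq A i | i <- s] p.1 p'.1 * kprod [seq B i | i <- s] p.2 p'.2 =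
  kprod [seq ktens (A i) (B i) | i <- s] p p'.
Proof.
elim: s p => [|i s IHs] [a b] /=.
  by case: p' => a' b' /=; rewrite -natrM mulnb xpair_eqE.
rewrite /kcomp big_distrlr pair_big /=; apply: eq_bigr => -[t u] _ /=.
by rewrite -IHs /ktens /= mulrACA.
Qed.

Lemma sum_pair (V : nmodType) (I J : finType) (G : I * J -> V) :
  \sum_p G p = \sum_i \sum_j G (i, j).
Proof. by rewrite pair_bigA; apply: eq_bigr => -[]. Qed.

Lemma sum_ffun_ordS (T : finType) n (F : {ffun 'I_n.+1 -> T} -> E) :
  \sum_f F f =
  \sum_t \sum_(g : {ffun 'I_n -> T})
     F [ffun i => if unlift ord0 i is Some j then g j else t].
Proof.
rewrite pair_big /=.
pose cons (p : T * {ffun 'I_n -> T}) : {ffun 'I_n.+1 -> T} :=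
  [ffun i => if unlift ord0 i is Some j then p.2 j else p.1].
pose uncons (f : {ffun 'I_n.+1 -> T}) : T * {ffun 'I_n -> T} :=
  (f ord0, [ffun i : 'I_n => f (lift ord0 i)]).
rewrite (reindex cons) //; exists uncons.
  move=> [t g] _; rewrite /uncons /cons ffunE unlift_none; congr pair.
  by apply/ffunP => i; rewrite !ffunE liftK.
move=> f _; apply/ffunP => i; rewrite ffunE /=.
by case: unliftP => [j|] ->; rewrite ?ffunE.
Qed.

(** The entries of a product of kernels are sums over paths with prescribed
    end points. *)
Lemma path_sum (T : finType) n (K : 'I_n -> T -> T -> E) a b :
  \sum_(h : {ffun 'I_n.+1 -> T} | (h ord0 == a) && (h ord_max == b))
     \prod_(c < n) K c (h (widen_ord (leqnSn n) c)) (h (lift ord0 c)) =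
  kprod [seq K c | c <- enum 'I_n] a b.
Proof.
elim: n => [|n IHn] in K a b *.
  have -> : enum 'I_0 = [::] by apply: size0nil; rewrite size_enum_ord.
  rewrite big_mkcond sum_ffun_ordS /=.
  transitivity (\sum_t ((t == a) && (t == b))%:R : E).
    apply: eq_bigr => t _; rewrite (big_pred1 [ffun=> a]) => [|g]; last first.
      by apply/esym/eqP/ffunP => -[].
    have -> : ord_max = ord0 :> 'I_1 by exact: val_inj.
    by rewrite !ffunE unlift_none big_ord0; case: ifP.
  rewrite (bigD1 a) //= eqxx big1 ?addr0 // => t /negPf->.
  by [].
rewrite enum_ordSl /= -map_comp.
rewrite big_mkcond sum_ffun_ordS /= (bigD1 a) //= [X in _ + X]big1 ?addr0.
  rewrite /kcomp.
  under [RHS]eq_bigr => t _.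
    rewrite -(IHn (fun c => K (lift ord0 c))) big_distrr big_mkcondl /=. over.
  rewrite exchange_big /= [RHS]big_mkcond; apply: eq_bigr => g _.
  have -> : ord_max = lift ord0 ord_max :> 'I_n.+2 by exact: val_inj.
  rewrite !ffunE unlift_none liftK eqxx /=; case: ifP => // _.
  rewrite (bigD1 (g ord0)) //= eqxx [X in _ = _ + X]big1 ?addr0; last first.
    by move=> t /negPf; rewrite eq_sym => ->.
  rewrite big_ord_recl; congr (_ * _).
    have -> : widen_ord (leqnSn n.+1) ord0 = ord0 by exact: val_inj.
    by rewrite !ffunE unlift_none liftK.
  apply: eq_bigr => c _.
  have -> : widen_ord (leqnSn n.+1) (lift ord0 c) =
            lift ord0 (widen_ord (leqnSn n) c) by exact: val_inj.
  by rewrite !ffunE !liftK.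
move=> t /negPf ta; apply: big1 => g _.
by rewrite ffunE unlift_none ta.
Qed.

(** Summing over one independent label per factor can be done factor by
    factor. *)
Lemma kprod_sum_ffun (S T : finType) n (K : 'I_n -> S -> T -> T -> E) a b :
  \sum_(w : {ffun 'I_n -> S}) kprod [seq K c (w c) | c <- enum 'I_n] a b =
  kprod [seq (fun t u => \sum_s K c s t u) | c <- enum 'I_n] a b.
Proof.
rewrite -(path_sum (fun c t u => \sum_s K c s t u)).
under eq_bigr do rewrite -(path_sum (fun c => K c _)).
rewrite exchange_big /=; apply: eq_bigr => h _.
by rewrite bigA_distr_bigA.
Qed.

End Kernels.

(** * The Yang-Baxter equation *)

(** The weights [ik_weight] multiplied by the common denominator
    (x - q^2 y) (x - q^3 y); these are polynomials in q, x and y. *)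
Definition ik_num (E : comPzRingType) (q x y : E) (i j k l : nat) : E :=
  let d := x - q ^+ 2 * y in
  let e := x - q ^+ 3 * y in
  match i, j, k, l with
  | 0%N, 0%N, 0%N, 0%N | 2%N, 2%N, 2%N, 2%N => d * e
  | 1%N, 0%N, 1%N, 0%N | 2%N, 1%N, 2%N, 1%N => q ^+ 2 * (x - y) * e
  | 1%N, 0%N, 0%N, 1%N | 2%N, 1%N, 1%N, 2%N => (1 - q ^+ 2) * x * e
  | 0%N, 1%N, 1%N, 0%N | 1%N, 2%N, 2%N, 1%N => (1 - q ^+ 2) * y * e
  | 0%N, 1%N, 0%N, 1%N | 1%N, 2%N, 1%N, 2%N => (x - y) * e
  | 2%N, 0%N, 2%N, 0%N => q ^+ 4 * (x - y) * (x - q * y)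
  | 2%N, 0%N, 1%N, 1%N => - (q * (1 - q) ^+ 2 * (1 + q) * x * (x - y))
  | 2%N, 0%N, 0%N, 2%N =>
      (1 - q ^+ 2) * x * (x + q * x - q * y - q ^+ 3 * y)
  | 1%N, 1%N, 2%N, 0%N => - (q ^+ 4 * (1 + q) * (x - y) * y)
  | 1%N, 1%N, 1%N, 1%N =>
      - (q * x ^+ 2) + (1 + q) * (1 - q ^+ 2 + q ^+ 4) * x * y
      - q ^+ 4 * y ^+ 2
  | 1%N, 1%N, 0%N, 2%N => (1 + q) * x * (x - y)
  | 0%N, 2%N, 2%N, 0%N =>
      (1 - q ^+ 2) * (x + q ^+ 2 * x - q ^+ 2 * y - q ^+ 3 * y) * y
  | 0%N, 2%N, 1%N, 1%N => q * (1 - q) ^+ 2 * (1 + q) * (x - y) * y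
  | 0%N, 2%N, 0%N, 2%N => (x - y) * (x - q * y)
  | _, _, _, _ => 0
  end.

(** The denominators of the weights of [ik_weight q x y] do not vanish. *)
Definition ik_regular (E : fieldType) (q x y : E) : Prop :=
  x - q ^+ 2 * y != 0 /\ x - q ^+ 3 * y != 0.

Lemma ik_weightE (E : fieldType) (q x y : E) (i j k l : 'I_3) :
  ik_regular q x y ->
  ik_weight q x y i j k l =
  ik_num q x y i j k l / ((x - q ^+ 2 * y) * (x - q ^+ 3 * y)).
Proof.
case=> dn0 en0; have den0 := mulf_neq0 dn0 en0.
have divE (a : E) : a / (x - q ^+ 2 * y) =
    a * (x - q ^+ 3 * y) / ((x - q ^+ 2 * y) * (x - q ^+ 3 * y)).
  by rewrite -mulf_div divff // mulr1.
case: i j k l => [[|[|[|//]]] ?] [[|[|[|//]]] ?] [[|[|[|//]]] ?] [[|[|[|//]]] ?];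
  rewrite /ik_weight /ik_num /= ?divE ?mul0r ?divff //.
Qed.

(** Particles are conserved at each vertex. *)
Lemma ik_num_conserved (E : comPzRingType) (q x y : E) (i j k l : nat) :
  ik_num q x y i j k l = 0 \/ (i + j = k + l)%N.
Proof.
by case: i j k l => [|[|[|?]]] [|[|[|?]]] [|[|[|?]]] [|[|[|?]]]; auto.
Qed.

(** Sum over the states of three edges, written out. *)
Definition sum_edges (E : comPzRingType) (F : nat -> nat -> nat -> E) : E :=
  let sum3 (f : nat -> E) := f 0%N + f 1%N + f 2%N in
  sum3 (fun t => sum3 (fun u => sum3 (fun w => F t u w))).

Lemma sum_edgesE (E : comPzRingType) (F : nat -> nat -> nat -> E) :
  \sum_(t < 3) \sum_(u < 3) \sum_(w < 3) F t u w = sum_edges F.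
Proof.
have sum3E (f : nat -> E) : \sum_(t < 3) f t = f 0%N + f 1%N + f 2%N.
  by rewrite !big_ord_recr big_ord0 /= add0r.
have sum3E1 t := sum3E (fun u => \sum_(w < 3) F t u w).
have sum3E2 t u := sum3E (F t u).
by rewrite (sum3E (fun t => \sum_(u < 3) \sum_(w < 3) F t u w)) !sum3E1 !sum3E2.
Qed.

(** The two sides of the Yang-Baxter equation, cleared of denominators: the
    horizontal lines of parameters [a] and [b] cross to the left, respectively
    to the right, of the vertical line of parameter [z]. The outer states are
    [i] and [k] at the bottom and top of the vertical line, and [j1], [j2] at
    the left and [m1], [m2] at the right of the lower and upper horizontal
    positions. *)
Definition yang_baxter_left (E : comPzRingType) (q a b z : E)
    (i k j1 j2 m1 m2 : nat) : E :=
  sum_edges (fun t1 t2 w => ik_num q a b j1 j2 t2 t1 *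
    (ik_num q a z i t1 w m1 * ik_num q b z w t2 k m2)).

Definition yang_baxter_right (E : comPzRingType) (q a b z : E)
    (i k j1 j2 m1 m2 : nat) : E :=
  sum_edges (fun t1 t2 w => (ik_num q b z i j1 w t1 * ik_num q a z w j2 k t2) *
    ik_num q a b t1 t2 m2 m1).

(** For outer states that violate particle conservation both sides are zero,
    so these are left out. *)
Lemma ik_num_yang_baxter (E : comPzRingType) (q a b z : E)
    (i k j1 j2 m1 m2 : nat) :
  (i < 3)%N -> (k < 3)%N -> (j1 < 3)%N -> (j2 < 3)%N -> (m1 < 3)%N ->
  (m2 < 3)%N -> (i + (j1 + j2))%N == (k + (m1 + m2))%N ->
  yang_baxter_left q a b z i k j1 j2 m1 m2 =
  yang_baxter_right q a b z i k j1 j2 m1 m2.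
Proof.
move: i k j1 j2 m1 m2.
do 6! [case=> [|[|[|?]]]] => //= _ _ _ _ _ _ _.
(* One polynomial identity is left for each of the 141 boundary states. *)
all: rewrite /yang_baxter_left /yang_baxter_right /sum_edges /=.
all: ring.
Qed.

(** The crossing of two horizontal lines, as a kernel on pairs of states of the
    lower and upper positions. The line of parameter [b], which plays the part
    of the vertical line in [ik_weight], goes from the lower position [j.1] on
    the left to the upper position [m.2] on the right, and the line of
    parameter [a] from [j.2] to [m.1]. *)
Definition crossing (E : fieldType) (q a b : E) (j m : 'I_3 * 'I_3) : E :=
  ik_weight q a b j.1 j.2 m.2 m.1.

(** Two vertices on a vertical line of parameter [z], with horizontal
    parameters [a] below and [b] above, and outer vertical states [i], [k]. *)
Definition two_vertices (E : fieldType) (q z a b : E) (i k : 'I_3) :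
    'I_3 * 'I_3 -> 'I_3 * 'I_3 -> E :=
  fun j m => \sum_w ktens (fun j1 m1 => ik_weight q a z i j1 w m1)
                          (fun j2 m2 => ik_weight q b z w j2 k m2) j m.

Lemma yang_baxter (E : fieldType) (q a b z : E) (i k : 'I_3) :
  ik_regular q a b -> ik_regular q a z -> ik_regular q b z ->
  kcomp (crossing q a b) (two_vertices q z a b i k) =2
  kcomp (two_vertices q z b a i k) (crossing q a b).
Proof.
move=> rab raz rbz [j1 j2] [m1 m2].
pose den x y : E := (x - q ^+ 2 * y) * (x - q ^+ 3 * y).
pose Z := (den a b * (den a z * den b z))^-1.
transitivity (yang_baxter_left q a b z i k j1 j2 m1 m2 * Z).
  rewrite /yang_baxter_left -sum_edgesE big_distrl.
  rewrite /kcomp sum_pair.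
  apply: eq_bigr => t1 _; rewrite big_distrl; apply: eq_bigr => t2 _ /=.
  rewrite /two_vertices big_distrr big_distrl; apply: eq_bigr => w _ /=.
  by rewrite /crossing /ktens /= !ik_weightE // !mulf_div.
transitivity (yang_baxter_right q a b z i k j1 j2 m1 m2 * Z); last first.
  rewrite /yang_baxter_right -sum_edgesE big_distrl.
  rewrite /kcomp sum_pair.
  apply: eq_bigr => t1 _; rewrite big_distrl; apply: eq_bigr => t2 _ /=.
  rewrite /two_vertices !big_distrl; apply: eq_bigr => w _ /=.
  rewrite /crossing /ktens /= !ik_weightE // !mulf_div; congr (_ / _).
  by rewrite /den; ring.
congr (_ * _).
case: (boolP ((i + (j1 + j2))%N == (k + (m1 + m2))%N)) => [cons|ncons].
  exact: ik_num_yang_baxter.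
rewrite /yang_baxter_left /yang_baxter_right -!sum_edgesE.
(* Without conservation of particles every term vanishes on both sides. *)
rewrite !big1 // => t1 _; rewrite big1 // => t2 _; rewrite big1 // => w _.
  have [->|e1] := ik_num_conserved q b z i j1 w t1; first by rewrite !mul0r.
  have [->|e2] := ik_num_conserved q a z w j2 k t2; first by rewrite mulr0 mul0r.
  have [->|e3] := ik_num_conserved q a b t1 t2 m2 m1; first by rewrite mulr0.
  by case/eqP: ncons; lia.
have [->|e1] := ik_num_conserved q a b j1 j2 t2 t1; first by rewrite mul0r.
have [->|e2] := ik_num_conserved q a z i t1 w m1; first by rewrite mul0r mulr0.
have [->|e3] := ik_num_conserved q b z w t2 k m2; first by rewrite !mulr0.
by case/eqP: ncons; lia.
Qed.

(** Two lines in the same state, 0 or 2, cross with weight 1 and without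
    changing state. *)
Lemma crossing_diag_l (E : fieldType) (q a b : E) (s : 'I_3) m :
  s \in [:: st0; st2] -> crossing q a b (s, s) m = ((s, s) == m)%:R.
Proof.
rewrite !inE; case: m => m1 m2.
by case/orP => /eqP->; case: m1 m2 => [[|[|[|//]]] ?] [[|[|[|//]]] ?].
Qed.

Lemma crossing_diag_r (E : fieldType) (q a b : E) (s : 'I_3) j :
  s \in [:: st0; st2] -> crossing q a b j (s, s) = (j == (s, s))%:R.
Proof.
rewrite !inE; case: j => j1 j2.
by case/orP => /eqP->; case: j1 j2 => [[|[|[|//]]] ?] [[|[|[|//]]] ?].
Qed.

(** * Commuting rows *)

(** The partition function of one row of parameter [a], as a kernel on the
    states of the vertical edges below and above it. *)
Definition row_weight (E : fieldType) (q : E) (L : nat) (z : 'I_L -> E)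
    (hl hr : 'I_3) (a : E) (u v : {ffun 'I_L -> 'I_3}) : E :=
  kprod [seq (fun j m => ik_weight q a (z c) (u c) j (v c) m) | c <- enum 'I_L]
    hl hr.

Lemma rows_two_vertices (E : fieldType) (q : E) (L : nat) (z : 'I_L -> E)
    (hl hr : 'I_3) (a b : E) (u v : {ffun 'I_L -> 'I_3}) :
  kcomp (row_weight q z hl hr a) (row_weight q z hl hr b) u v =
  kprod [seq two_vertices q (z c) a b (u c) (v c) | c <- enum 'I_L]
    (hl, hl) (hr, hr).
Proof.
rewrite /two_vertices -kprod_sum_ffun; apply: eq_bigr => w _.
exact: (kprod_tens _ _ _ (hl, hl) (hr, hr)).
Qed.

(** The crossing is inserted at the left boundary, where it acts trivially,
    moved through all the columns, and removed at the right boundary. *)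
Lemma row_weight_comm (E : fieldType) (q : E) (L : nat) (z : 'I_L -> E)
    (hl hr : 'I_3) (a b : E) :
  hl \in [:: st0; st2] -> hr \in [:: st0; st2] -> ik_regular q a b ->
  (forall c, ik_regular q a (z c)) -> (forall c, ik_regular q b (z c)) ->
  kcomp (row_weight q z hl hr a) (row_weight q z hl hr b) =2
  kcomp (row_weight q z hl hr b) (row_weight q z hl hr a).
Proof.
move=> hl02 hr02 rab raz rbz u v; rewrite !rows_two_vertices.
have := kprod_intertwine (R := crossing q a b)
  (A := fun c => two_vertices q (z c) a b (u c) (v c))
  (B := fun c => two_vertices q (z c) b a (u c) (v c)) (enum 'I_L)
  (fun c => yang_baxter (u c) (v c) rab (raz c) (rbz c)) (hl, hl) (hr, hr).
rewrite /kcomp.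
under eq_bigr do rewrite crossing_diag_l //.
under [X in _ = X]eq_bigr do rewrite crossing_diag_r //.
by move=> e; apply: etrans (etrans e _); [exact/esym/kcomp1k | exact: kcompk1].
Qed.

(** The lattice sum is the product of the kernels of its rows. *)
Lemma lattice_sum_rows (E : fieldType) (q : E) (R L : nat)
    (x : 'I_R -> E) (z : 'I_L -> E) (hl hr : 'I_3) (vb vt : 'I_L -> 'I_3) :
  lattice_sum q x z hl hr vb vt =
  kprod [seq row_weight q z hl hr (x r) | r <- enum 'I_R] (finfun vb) (finfun vt).
Proof.
rewrite -(path_sum (fun r => row_weight q z hl hr (x r))).
rewrite /lattice_sum exchange_big /=.
(* Pair-indexed families of states are families of rows. *)
pose uncurry (w : {ffun 'I_R.+1 -> {ffun 'I_L -> 'I_3}}) :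
  {ffun 'I_R.+1 * 'I_L -> 'I_3} := [ffun p => w p.1 p.2].
pose curry (v : {ffun 'I_R.+1 * 'I_L -> 'I_3}) :
  {ffun 'I_R.+1 -> {ffun 'I_L -> 'I_3}} := [ffun r => [ffun c => v (r, c)]].
rewrite (reindex uncurry) /=; last first.
  exists curry => w _; first by apply/ffunP => r; apply/ffunP => c; rewrite !ffunE.
  by apply/ffunP => -[r c]; rewrite !ffunE.
apply: eq_big => [w|w _].
  apply/forallP/andP => [bd|[/eqP b0 /eqP b1] c].
    by split; apply/eqP/ffunP => c; have /andP[/eqP b0 /eqP b1] := bd c;
       rewrite ffunE -?b0 -?b1 ffunE.
  by rewrite !ffunE b0 b1 !ffunE !eqxx.
pose uncurryh (w : {ffun 'I_R -> {ffun 'I_L.+1 -> 'I_3}}) :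
  {ffun 'I_R * 'I_L.+1 -> 'I_3} := [ffun p => w p.1 p.2].
pose curryh (v : {ffun 'I_R * 'I_L.+1 -> 'I_3}) :
  {ffun 'I_R -> {ffun 'I_L.+1 -> 'I_3}} := [ffun r => [ffun c => v (r, c)]].
rewrite (reindex uncurryh) /=; last first.
  exists curryh => h _; first by apply/ffunP => r; apply/ffunP => c; rewrite !ffunE.
  by apply/ffunP => -[r c]; rewrite !ffunE.
rewrite /row_weight.
under [RHS]eq_bigr => r _ do rewrite -(path_sum (fun c j m =>
  ik_weight q (x r) (z c) (w (widen_ord (leqnSn R) r) c) j (w (lift ord0 r) c) m)).
rewrite bigA_distr_big_dep; apply: eq_big => [h|h _].
  by apply/forallP/familyP => bd r; have := bd r; rewrite !ffunE.
by apply: eq_bigr => r _; apply: eq_bigr => c _; rewrite !ffunE.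
Qed.

Lemma lattice_sum_perm (E : fieldType) (q : E) (R L : nat)
    (x : 'I_R -> E) (z : 'I_L -> E) (hl hr : 'I_3) (vb vt : 'I_L -> 'I_3)
    (t : 'I_R -> 'I_R) :
  hl \in [:: st0; st2] -> hr \in [:: st0; st2] ->
  (forall r s, ik_regular q (x r) (x s)) ->
  (forall r c, ik_regular q (x r) (z c)) -> injective t ->
  lattice_sum q (x \o t) z hl hr vb vt = lattice_sum q x z hl hr vb vt.
Proof.
move=> hl02 hr02 rxx rxz t_inj; rewrite !lattice_sum_rows.
rewrite (map_comp (fun r => row_weight q z hl hr (x r)) t).
apply: kprod_perm; first by move=> r s; exact: row_weight_comm.
apply: uniq_perm => [||r]; rewrite ?(map_inj_uniq t_inj) ?enum_uniq //.
have [t' tK t'K] := injF_bij t_inj.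
by rewrite mem_enum -[r]t'K map_f ?mem_enum.
Qed.

(** * Permutations of the variables of a rational function *)

Lemma frac_repr (R : idomainType) (f : {fraction R}) :
  exists a b : R, b != 0 /\ f = FracField.tofrac a / FracField.tofrac b.
Proof.
exists \n_(generic_quotient.repr f), \d_(generic_quotient.repr f).
set r := generic_quotient.repr f; have d0 : \d_r != 0 by exact: denom_ratioP.
split=> //; apply: (canRL (mulfK _)); first by rewrite tofrac_eq0.
rewrite -[f]generic_quotient.reprK -/r.
unlock FracField.tofrac; rewrite -[LHS]FracField.pi_mul.
apply/eqP; rewrite FracField.equivf_def /FracField.mulf.
by rewrite !numden_Ratio ?mulf_neq0 ?oner_eq0 // !mulr1 mulrC.
Qed.

Section RatSym.

Variables (K : fieldType) (n : nat) (s : 'S_n).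

Local Notation tofrac := (@FracField.tofrac {mpoly K[n]}).

Lemma ratsym_tofrac (p : {mpoly K[n]}) :
  ratsym s (tofrac p) = tofrac (msym s p).
Proof.
have := ratsym_frac s p (oner_neq0 _).
by rewrite msym1 tofrac1 !divr1.
Qed.

Lemma ratsym_var (i : 'I_n) : ratsym s (tofrac 'X_i) = tofrac 'X_(s i).
Proof.
rewrite ratsym_tofrac msymX; congr (tofrac 'X_[_]).
apply/mnmP => j; rewrite mnmE !mnm1E.
by rewrite -(inj_eq (@perm_inj _ s) i) permKV.
Qed.

Lemma msym_eq0 (p : {mpoly K[n]}) : (msym s p == 0) = (p == 0).
Proof. by rewrite -(inj_eq (inj_msym s) p) msym0. Qed.

Lemma ratsym_zmod_morphism : zmod_morphism (ratsym s : {fraction {mpoly K[n]}} -> _).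
Proof.
move=> f g; have [a [b [b0 ->]]] := frac_repr f.
have [c [d [d0 ->]]] := frac_repr g.
rewrite !ratsym_frac // -!mulNr !addf_div ?tofrac_eq0 ?msym_eq0 //.
rewrite -!tofracN -!tofracM -!tofracD ratsym_frac ?mulf_neq0 //.
by rewrite msymD !msymM msymN.
Qed.

Lemma ratsym_monoid_morphism :
  monoid_morphism (ratsym s : {fraction {mpoly K[n]}} -> _).
Proof.
split; first by rewrite -tofrac1 ratsym_tofrac msym1.
move=> f g; have [a [b [b0 ->]]] := frac_repr f.
have [c [d [d0 ->]]] := frac_repr g.
rewrite !ratsym_frac // !mulf_div -!tofracM ratsym_frac ?mulf_neq0 //.
by rewrite !msymM.
Qed.

HB.instance Definition _ :=
  GRing.isZmodMorphism.Build _ _ (ratsym s) ratsym_zmod_morphism.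
HB.instance Definition _ :=
  GRing.isMonoidMorphism.Build _ _ (ratsym s) ratsym_monoid_morphism.

End RatSym.

Lemma ik_weight_rmorph (E E' : fieldType) (f : {rmorphism E -> E'}) (q x y : E)
    (i j k l : 'I_3) :
  f (ik_weight q x y i j k l) = ik_weight (f q) (f x) (f y) i j k l.
Proof.
have fE := (rmorphXn f, fmorphV f, rmorphD f, rmorphB f, rmorphN f, rmorphM f,
  rmorph1 f, rmorph0 f).
case: i j k l => [[|[|[|//]]] ?] [[|[|[|//]]] ?] [[|[|[|//]]] ?] [[|[|[|//]]] ?];
  by rewrite /ik_weight /= ?fE.
Qed.

Lemma lattice_sum_rmorph (E E' : fieldType) (f : {rmorphism E -> E'}) (q : E)
    (R L : nat) (x : 'I_R -> E) (z : 'I_L -> E) (hl hr : 'I_3)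
    (vb vt : 'I_L -> 'I_3) :
  f (lattice_sum q x z hl hr vb vt) =
  lattice_sum (f q) (f \o x) (f \o z) hl hr vb vt.
Proof.
rewrite rmorph_sum; apply: eq_bigr => h _; rewrite rmorph_sum.
apply: eq_bigr => v _; rewrite rmorph_prod; apply: eq_bigr => r _.
by rewrite rmorph_prod; apply: eq_bigr => c _; exact: ik_weight_rmorph.
Qed.

(** The two monomials of the difference have different degrees. *)
Lemma ratvar_regular (K : fieldType) (R L : nat) (i j : 'I_(1 + R + L)) :
  ik_regular (ratvar K (qidx R L)) (ratvar K i) (ratvar K j).
Proof.
suff neq k : ratvar K i - ratvar K (qidx R L) ^+ k.+1 * ratvar K j != 0 by [].
rewrite /ratvar -tofracXn -tofracM -tofracB tofrac_eq0 subr_eq0.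
rewrite mpolyXn -mpolyXD; apply/eqP => /(congr1 (fun p => p@_U_(i))).
rewrite !mcoeffX eqxx; case: eqP => [/(congr1 mdeg)|_ /eqP]; last first.
  by rewrite oner_eq0.
by rewrite mdegD mdegMn !mdeg1 mul1n addn1.
Qed.

(** The only condition is on the states at the left and right ends of the rows,
    which are such that the crossing acts trivially on them; the bottom and top
    boundaries are arbitrary. *)
Lemma lattice_sum_symmetric (K : fieldType) (R L : nat) (hl hr : 'I_3)
    (vb vt : 'I_L -> 'I_3) :
  hl \in [:: st0; st2] -> hr \in [:: st0; st2] ->
  symmetric_in_x (lattice_sum (ratvar K (qidx R L))
    (fun r => ratvar K (xidx L r)) (fun c => ratvar K (zidx R c)) hl hr vb vt).
Proof.
move=> hl02 hr02 s s_on.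
have x_neq_q r : xidx L r != qidx R L.
  by rewrite -val_eqE.
have sq : s (qidx R L) = qidx R L.
  apply: (out_perm s_on); apply/imsetP => -[r _ /eqP].
  by rewrite eq_sym (negPf (x_neq_q r)).
have sz c : s (zidx R c) = zidx R c.
  apply: (out_perm s_on); apply/imsetP => -[r _ /(congr1 val) /=].
  by have := ltn_ord r; lia.
have ex r : exists r', s (xidx L r) == xidx L r'.
  have : s (xidx L r) \in [set xidx L r | r : 'I_R].
    by rewrite perm_closed // imset_f.
  by case/imsetP => r' _ ->; exists r'.
(* The permutation of the rows induced by [s]. *)
pose t r := xchoose (ex r).
have st r : s (xidx L r) = xidx L (t r) by apply/eqP/(xchooseP (ex r)).
have t_inj : injective t.
  move=> r r' /(congr1 (xidx L)); rewrite -!st => /perm_inj /(congr1 val) /=.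
  by move/addnI/val_inj.
rewrite (lattice_sum_rmorph (ratsym s)) /=.
rewrite -[RHS](lattice_sum_perm _ _ hl02 hr02 _ _ t_inj);
  try by move=> *; exact: ratvar_regular.
rewrite /lattice_sum; apply: eq_bigr => h _; apply: eq_bigr => v _.
apply: eq_bigr => r _; apply: eq_bigr => c _ /=.
by rewrite !ratsym_var sq sz st.
Qed.

Theorem theorem1p5p3 (K : fieldType) (N M : nat) (S : two_string)
    (hN : (1 <= N)%N) (hM : (1 <= M)%N) (hS : string_size S = (2 * N)%N) :
  (forall L : nat, string_length_le S L -> symmetric_in_x (F_fun K N L S)) /\
  (forall L : nat, (N <= L)%N -> string_length_le S L ->
     symmetric_in_x (G_fun K N M L S)).
Proof. by split=> *; apply: lattice_sum_symmetric. Qed.
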